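(* Assume the following. (1) There exists $\theta^*\in\Theta$ such that $\theta^*=\arg\min_{\theta\in\Theta}E\log\frac{p_0}{f_\theta}$, and $\theta^*$ is in the $d$-support of $\Pi$ (every $d$-neighborhood of $\theta^*$ has positive $\Pi$-probability). (2) The map $\theta\mapsto E\log\frac{f_\theta}{f_{\theta^*}}$ is continuous on $\Theta$ with respect to $d$, and for every $\theta_1\in\Theta$ the map $\theta\mapsto E\left[\frac{f_\theta}{f_{\theta_1}}\right]$ is continuous on $\Theta$ with respect to $d$. (3) For every $\eta>0$, the neighborhood $\{\theta\in\Theta: d(\theta,\theta^* )<\eta\}$ contains a set of the form $\{\theta\in\Theta: E\log\frac{f_{\theta^*}}{f_\theta}<\delta\}$ for some $\delta\in(0,1)$. Suppose in addition that $\Theta$ is compact (with respect to $d$). Then for every $\epsilon>0$, with $U^c=\{\theta\in\Theta: d(\theta,\theta^* )>\epsilon\}$, $$\Pi_n(U^c)\to 0\quad\text{almost surely } P_0 \text{ as } n\to\infty.$$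
   Context: $Y_1,Y_2,\ldots$ are i.i.d. with true density $p_0$; $P_0=p_0^{\infty}$ denotes the infinite product measure and $E[\cdot]$ is expectation with respect to it. In expressions such as $E\log\frac{f_\theta}{f_{\theta'}}$ or $E\left[\frac{f_\theta}{f_{\theta'}}\right]$ the densities are evaluated at a random variable $Y$ with density $p_0$. The specified model is a family of densities $\{f_\theta:\theta\in\Theta\}$ (with respect to the same dominating measure), which need not contain $p_0$. $\Theta$ is a metric space with metric $d$, and $\Pi$ is a prior probability measure on $\Theta$. Usual measurability of $(\theta,y)\mapsto f_\theta(y)$ is implicit. The posterior probability of a measurable set $B\subseteq\Theta$ is $$\Pi_n(B)=\frac{\int_B\prod_{i=1}^n\frac{f_\theta(Y_i)}{f_{\theta^*}(Y_i)}\,d\Pi(\theta)}{\int_\Theta\prod_{i=1}^n\frac{f_\theta(Y_i)}{f_{\theta^*}(Y_i)}\,d\Pi(\theta)}.$$ *)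

(* Defs.v *)
From HB Require Import structures.
From mathcomp Require Export all_boot all_order all_algebra.
From mathcomp Require Export finmap.
From mathcomp Require Export all_classical all_reals all_analysis.
Export Order.TTheory GRing.Theory Num.Theory.
Export numFieldNormedType.Exports.

#[export] Set Implicit Arguments.
#[export] Unset Strict Implicit.
#[export] Unset Printing Implicit Defensive.

#[global] Open Scope classical_set_scope.
#[global] Open Scope ring_scope.

(* Measurable types are pointed, so a metric space must be pointed (that is,
   nonempty) to carry its Borel sigma-algebra as an instance. *)
#[short(type="pmetricType")]
HB.structure Definition PMetric (K : numDomainType) :=
  { M of Metric K M & isPointed M }.

Notation borel T := (g_sigma_algebraType (@open T)).

Section misspecified_model.
Local Open Scope ereal_scope.
Context {R : realType} {dX : measure_display} {X : measurableType dX}.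

Definition is_density (mu : {measure set X -> \bar R}) (p : X -> R) : Prop :=
  [/\ measurable_fun [set: X] p, (forall x, (0 <= p x)%R) &
      \int[mu]_x (p x)%:E = 1].

Context {dW : measure_display} {W : measurableType dW}.

Definition has_density (P : probability W R) (mu : {measure set X -> \bar R})
    (Y : {RV P >-> X}) (p : X -> R) : Prop :=
  forall A : set X, measurable A ->
    distribution P Y A = \int[mu]_(x in A) (p x)%:E.

Definition mutually_independent (P : probability W R)
    (Y : nat -> {RV P >-> X}) : Prop :=
  forall (J : {fset nat}) (A : nat -> set X),
    (forall i, measurable (A i)) ->
    P (\bigcap_(i in [set` J]) (Y i @^-1` A i)) =
    \prod_(i <- J) P (Y i @^-1` A i).

Definition iid_with_density (P : probability W R)
    (mu : {measure set X -> \bar R}) (Y : nat -> {RV P >-> X})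
    (p : X -> R) : Prop :=
  mutually_independent Y /\ (forall i, has_density mu (Y i) p).

(* Division in \bar R: c / 0 = +oo for c > 0, and 0 / 0 = 0. *)
Definition ratio (p q : X -> R) (x : X) : \bar R := (p x)%:E / (q x)%:E.

(* Values in \bar R, with lne 0 = -oo and lne +oo = +oo; a Kullback-Leibler
   divergence may be +oo. An expectation whose positive and negative parts are
   both infinite is -oo, by +oo - +oo = -oo in \bar R. *)
Definition mean_ratio (P : probability W R) (Y : {RV P >-> X})
    (p q : X -> R) : \bar R :=
  \int[P]_w ratio p q (Y w).

Definition mean_log_ratio (P : probability W R) (Y : {RV P >-> X})
    (p q : X -> R) : \bar R :=
  \int[P]_w lne (ratio p q (Y w)).

Context {Theta : pmetricType R}.

Definition likelihood_ratio (P : probability W R) (Y : nat -> {RV P >-> X})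
    (f : Theta -> X -> R) (theta0 : Theta) (n : nat) (w : W)
    (theta : Theta) : \bar R :=
  \prod_(i < n) ratio (f theta) (f theta0) (Y i w).

Definition posterior (P : probability W R) (Y : nat -> {RV P >-> X})
    (Pi : probability (borel Theta) R) (f : Theta -> X -> R) (theta0 : Theta)
    (n : nat) (w : W) (B : set Theta) : \bar R :=
  (\int[Pi]_(theta in B) likelihood_ratio Y f theta0 n w theta) /
  (\int[Pi]_theta likelihood_ratio Y f theta0 n w theta).

Definition in_support (Pi : probability (borel Theta) R)
    (theta : Theta) : Prop :=
  forall r : R, (0 < r)%R -> 0 < Pi [set theta' | (mdist theta' theta < r)%R].

End misspecified_model.

(* Main.v *)
From HB Require Import structures.
From mathcomp Require Import ring lra measurable_realfun.
Require Import Defs.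

(** Write [L_n] for the product of the ratios [f theta / f thetastar] over the
    first [n] observations. The posterior mass of the parameters far from
    [thetastar] is the quotient of the integral of [L_n] over them by its
    integral over the whole parameter space; for a suitable [k > 0] the first is
    shown to be negligible with respect to [expR (- k * n)] and the second to
    dominate it.

    The only limit theorem behind this is [product_growth]: if [c] is less than
    the mean of [lne Z] then the product of [n] independent copies of [Z]
    almost surely dominates [expR (c * n)]. Taking logarithms, it rests on the
    fact that a random walk with negative drift is almost surely bounded above
    ([walk_sup_fin]), which is proved directly on the space of sample paths,
    from the invariance of the law of an i.i.d. sequence under prefixing an
    independent observation ([iid_law]), by integrating the recursion satisfied
    by the running maximum over the event that the maximum diverges. Only nonnegative integrals occur,
    so logarithms of infinite mean and densities with zeros cause no trouble.

    Denominator. The mean of the log-ratio is continuous and is zero at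
    [thetastar], so it exceeds [- k] on an open neighbourhood, which has positive
    prior mass. There [product_growth] applies to each parameter; Fubini and
    Fatou turn this into growth of the integral ([denominator_growth]).

    Numerator. A far parameter [theta1] has mean of [lne (f thetastar / f theta1)]
    at least some fixed [delta > 0], so the product of the
    [f theta1 / f thetastar] decays exponentially, by [product_growth] again. The
    mean of [f theta / f theta1] is at most 1 at [theta = theta1], so by
    continuity it is at most [expR g], with [g] small, on an open set around
    [theta1]; the integral of the product of these ratios over that set then has
    mean at most [expR (g * n)], and is almost surely of that order up to a
    slightly larger rate ([integral_prod_bound]). Multiplying the two factors
    gives decay over the open set ([local_numerator_decay]), and compactness
    covers the far parameters by finitely many such sets ([numerator_decay]). *)

Local Open Scope ereal_scope.

(** * Measurability of logarithms, ratios and products *)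

Section measurability.
Context {R : realType} {d : measure_display} {T : measurableType d}.

Lemma measurable_lne (g : T -> \bar R) :
  measurable_fun [set: _] g -> measurable_fun [set: _] (fun t => lne (g t)).
Proof.
move=> mg.
rewrite (_ : (fun t => _) = fun t => if g t <= 0 then -oo else
    if +oo <= g t then +oo else (ln (fine (g t)))%:E); last first.
  apply/funext => t; case: (g t) => [r| |]/=; 
    rewrite ?lee_fin ?leNye ?leye_eq//.
apply: measurable_fun_ifT => //.
  apply: (measurable_fun_bool true).
  exact: emeasurable_fun_infty_c.
apply: measurable_fun_ifT => //.
  apply: (measurable_fun_bool true).
  exact: emeasurable_fun_c_infty.
apply/measurable_EFinP; apply: measurableT_comp; first exact: measurable_ln.
exact: measurableT_comp.
Qed.

Lemma ratio_ge0 (p q : T -> R) : (forall t, 0 <= p t)%R ->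
  (forall t, 0 <= q t)%R -> forall t, 0 <= ratio p q t.
Proof. by move=> p0 q0 t; rewrite mule_ge0 ?inve_ge0 ?lee_fin. Qed.

Lemma measurable_ratio (p q : T -> R) : (forall t, 0 <= q t)%R ->
  measurable_fun [set: _] p -> measurable_fun [set: _] q ->
  measurable_fun [set: _] (ratio p q).
Proof.
move=> q0 mp mq; apply: emeasurable_funM; first exact/measurable_EFinP.
rewrite (_ : (fun t => _) = fun t => if (q t <= 0)%R then +oo else
   (q t `^ (-1))%:E); last first.
  apply/funext => t; rewrite inver powR_inv1//.
  by rewrite eq_le q0 andbT.
apply: measurable_fun_ifT => //.
  exact: measurable_fun_ler.
apply/measurable_EFinP.
exact: (measurableT_comp (measurable_powR (-1)%R) mq).
Qed.

Lemma measurable_prode (n : nat) (g : nat -> T -> \bar R) :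
  (forall i, measurable_fun [set: _] (g i)) ->
  measurable_fun [set: _] (fun t => \prod_(i < n) g i t).
Proof.
move=> mg; elim: n => [|n IH].
  by under eq_fun do rewrite big_ord0; exact: measurable_cst.
under eq_fun do rewrite big_ord_recr /=.
exact: emeasurable_funM.
Qed.

End measurability.

(** * The space of sample paths *)

Definition cylinders d (X : measurableType d) : set (set (nat -> X)) :=
  [set C | exists2 A : nat -> set X, (forall i, measurable (A i)) &
     exists n, C = [set s | forall i, (i < n)%N -> A i (s i)]].

(** The countable power of [X], with the sigma-algebra generated by cylinders;
    it hosts the joint law of the observations. *)
Definition paths d (X : measurableType d) : measurableType (@cylinders d X).-sigma :=
  g_sigma_algebraType (@cylinders d X).

Section paths.
Context d (X : measurableType d).

Definition cons_path (z : X * paths X) : paths X :=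
  fun n => if n is m.+1 then z.2 m else z.1.

(** Cylinders over the first [n] coordinates form a pi-system, so a finite
    measure on paths is determined by its values on them. *)
Lemma setI_closed_cylinders : setI_closed (@cylinders d X).
Proof.
move=> _ _ [A mA [n ->]] [B mB [m ->]].
(* [A] and [B] may be nontrivial beyond [n] and [m]; there they must not
   constrain the intersection. *)
exists (fun i => (if (i < n)%N then A i else setT) `&`
                 (if (i < m)%N then B i else setT)).
  by move=> i; apply: measurableI; case: ifP.
exists (maxn n m); apply/seteqP; split => s /=.
  by move=> [hA hB] i _; split; case: ifPn => // ?; [exact: hA|exact: hB].
move=> h; split => i il.
- have [|+ _] := h i; first by rewrite leq_max il.
  by rewrite il.
- have [|_ +] := h i; first by rewrite leq_max il orbT.
  by rewrite il.
Qed.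

Lemma measurable_cylinder (A : nat -> set X) n : (forall i, measurable (A i)) ->
  measurable ([set s | forall i, (i < n)%N -> A i (s i)] : set (paths X)).
Proof. by move=> mA; apply: sub_sigma_algebra; exists A => //; exists n. Qed.

Lemma measurable_to_paths d' (W : measurableType d') (g : W -> paths X) :
  (forall i, measurable_fun [set: _] (fun w => g w i)) -> measurable_fun [set: _] g.
Proof.
move=> mg; apply: (@measurability _ _ W (paths X) _ g (@cylinders d X)) => //.
move=> _ [_ [A mA [n ->]] <-]; rewrite setTI.
rewrite (_ : _ @^-1` _ = \bigcap_(i in `I_n) ((fun w => g w i) @^-1` A i)).
  apply: bigcap_measurableType => i _.
  by rewrite -[X in measurable X]setTI; apply: mg.
by apply/seteqP; split.
Qed.

Lemma measurable_coord (i : nat) : measurable_fun [set: _] (fun s : paths X => s i).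
Proof.
move=> _ B mB; rewrite setTI.
pose A j := if j == i then B else setT.
rewrite (_ : _ @^-1` _ = [set s | forall j, (j < i.+1)%N -> A j (s j)]).
  by apply: measurable_cylinder => j; rewrite /A; case: ifP.
apply/seteqP; split => s /=.
  by move=> sB j _; rewrite /A; case: eqP => [->|].
by move=> /(_ i (leqnn _)); rewrite /A eqxx.
Qed.

Lemma measurable_cons_path : measurable_fun [set: _] cons_path.
Proof.
apply: measurable_to_paths => -[|i] /=; first exact: measurable_fst.
exact: (measurableT_comp (measurable_coord i) measurable_snd).
Qed.

End paths.

HB.instance Definition _ d (X : measurableType d) :=
  isMeasurableFun.Build _ _ _ _ (@cons_path d X) (@measurable_cons_path d X).

Lemma product_probability1E {R : realType} d1 d2 (T1 : measurableType d1)
    (T2 : measurableType d2) (P1 : probability T1 R) (P2 : probability T2 R)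
    (A : set T1) (B : set T2) : measurable A -> measurable B ->
  (P1 \x P2) (A `*` B) = P1 A * P2 B.
Proof. exact: product_measure1E. Qed.

Lemma integral_probability_cst {R : realType} d (T : measurableType d)
    (P : probability T R) (c : \bar R) : \int[P]_x c = c.
Proof. by rewrite integral_cst//= probability_setT mule1. Qed.

Section iid_law.
Context {R : realType} {d : measure_display} {X : measurableType d}.

(** [Q] is the law of an i.i.d. sequence with marginal [nu], expressed as
    invariance: putting an independent [nu]-distributed head in front of a
    [Q]-distributed path gives a [Q]-distributed path. This single identity
    yields both independence and stationarity in all the integral computations
    below. *)
Definition iid_law (nu : probability X R) (Q : probability (paths X) R) :=
  forall A, measurable A -> Q A = (nu \x Q) (@cons_path d X @^-1` A).

(** On a cylinder the invariance says that a product of [n] factors is its first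
    factor times the product of the others; uniqueness of measures does the
    rest. *)
Lemma iid_law_cylinder (nu : probability X R) (Q : probability (paths X) R) :
  (forall (A : nat -> set X) n, (forall i, measurable (A i)) ->
    Q [set s | forall i, (i < n)%N -> A i (s i)] = \prod_(i < n) nu (A i)) ->
  iid_law nu Q.
Proof.
move=> QE A mA.
apply: (@measure_unique _ R (paths X) (@cylinders d X) (fun=> setT) _ _ _ _ Q
  (pushforward (nu \x Q)%E (@cons_path d X))) => //.
- exact: setI_closed_cylinders.
- move=> _; exists (fun=> setT) => //; exists 0%N.
  by apply/seteqP; split.
- by rewrite bigcup_const.
- move=> _ [B mB [n ->]]; transitivity (\prod_(i < n) nu (B i)); first exact: QE.
  change (\prod_(i < n) nu (B i) = (nu \x Q) (@cons_path d X @^-1`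
    [set s | forall i, (i < n)%N -> B i (s i)])).
  case: n => [|n].
    rewrite big_ord0 (_ : _ @^-1` _ = setT `*` setT).
      by rewrite product_probability1E// !probability_setT mule1.
    by apply/seteqP; split.
  rewrite (_ : _ @^-1` _ = B 0%N `*` [set s | forall i, (i < n)%N -> B i.+1 (s i)]).
    rewrite product_probability1E//; last first.
      by apply: (@measurable_cylinder _ _ (fun i => B i.+1)).
    by rewrite (QE (fun i => B i.+1))// big_ord_recl.
  apply/seteqP; split => -[x s] /=.
    by move=> h; split => [|i il]; [exact: (h 0%N)|exact: (h i.+1)].
  by move=> [h0 h] [|i] il; [exact: h0|exact: h].
- by move=> _; rewrite -ge0_fin_numE// fin_num_measure.
Qed.

End iid_law.

Section sample_path.
Context {R : realType} {d dW : measure_display} {X : measurableType d}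
  {W : measurableType dW} (P : probability W R).

Definition sample_path (Y : nat -> {RV P >-> X}) (w : W) : paths X :=
  fun i => Y i w.

Lemma measurable_sample_path (Y : nat -> {RV P >-> X}) :
  measurable_fun [set: _] (sample_path Y).
Proof. by apply: measurable_to_paths => i; exact: measurable_funPT. Qed.

HB.instance Definition _ (Y : nat -> {RV P >-> X}) :=
  isMeasurableFun.Build _ _ _ _ (sample_path Y) (measurable_sample_path Y).

Lemma iid_law_sample_path (mu : {measure set X -> \bar R})
    (Y : nat -> {RV P >-> X}) (p : X -> R) :
  iid_with_density mu Y p ->
  iid_law (distribution P (Y 0%N)) (distribution P (sample_path Y)).
Proof.
move=> [indY densY]; apply: iid_law_cylinder => A n mA.
rewrite /distribution /pushforward /=.
pose J := [fset i in iota 0 n]%fset.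
have JE i : (i \in J) = (i < n)%N by rewrite inE /= mem_iota.
transitivity (P (\bigcap_(i in [set` J]) (Y i @^-1` A i))).
  congr (P _); apply/seteqP; split => w /= h i.
    by rewrite /= JE => il; exact: h.
  by move=> il; apply: h; rewrite /= JE.
rewrite indY// (perm_big (iota 0 n)) /=; last first.
  by apply: uniq_perm; rewrite ?fset_uniq ?iota_uniq// => i; rewrite JE mem_iota.
rewrite -{1}[n]subn0 -/(index_iota 0 n) big_mkord.
apply: eq_bigr => i _.
by have := densY i _ (mA i); rewrite -(densY 0%N _ (mA i)).
Qed.

Lemma ae_sample_path (Y : nat -> {RV P >-> X}) (G : set (paths X)) :
  {ae distribution P (sample_path Y), forall s : paths X, G s} ->
  {ae P, forall w, G (sample_path Y w)}.
Proof.
move=> [N [mN N0 GN]]; exists (sample_path Y @^-1` N); split => //.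
- by rewrite -[X in measurable X]setTI; exact: measurable_sample_path.
- by move=> w /= h; exact: GN.
Qed.

End sample_path.

(** * Integration against the law of an i.i.d. sequence *)

Section iid_integral.
Context {R : realType} {d : measure_display} {X : measurableType d}.
Variables (nu : probability X R) (Q : probability (paths X) R).
Hypothesis QE : iid_law nu Q.

Lemma ge0_integral_cons_path (F : paths X -> \bar R) :
  measurable_fun [set: _] F -> (forall s, 0 <= F s) ->
  \int[Q]_s F s = \int[(nu \x Q)]_z F (cons_path z).
Proof.
move=> mF F0.
rewrite (eq_measure_integral (pushforward (nu \x Q) (@cons_path d X))).
  by rewrite ge0_integral_pushforward.
by move=> A mA _; exact: QE.
Qed.

Lemma ge0_integral_fst (F : X -> \bar R) :
  measurable_fun [set: _] F -> (forall x, 0 <= F x) ->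
  \int[(nu \x Q)]_z F z.1 = \int[nu]_x F x.
Proof.
move=> mF F0; rewrite fubini_tonelli1//=; last first.
  exact: measurableT_comp.
apply: eq_integral => x _.
by rewrite -[RHS](integral_probability_cst Q).
Qed.

Lemma ge0_integral_snd (F : paths X -> \bar R) :
  measurable_fun [set: _] F -> (forall x, 0 <= F x) ->
  \int[(nu \x Q)]_z F z.2 = \int[Q]_x F x.
Proof.
move=> mF F0; rewrite fubini_tonelli2//=; last first.
  exact: measurableT_comp.
apply: eq_integral => x _.
by rewrite -[RHS](integral_probability_cst nu).
Qed.

Lemma ge0_integral_fstMsnd (F : X -> \bar R) (G : paths X -> \bar R) :
  measurable_fun [set: _] F -> (forall x, 0 <= F x) ->
  measurable_fun [set: _] G -> (forall s, 0 <= G s) ->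
  \int[(nu \x Q)]_z (F z.1 * G z.2) = \int[nu]_x F x * \int[Q]_s G s.
Proof.
move=> mF F0 mG G0; rewrite fubini_tonelli1//=; last 2 first.
- by apply: emeasurable_funM; exact: measurableT_comp.
- by move=> z; exact: mule_ge0.
rewrite -ge0_integralZr//; last exact: integral_ge0.
apply: eq_integral => x _.
by rewrite /fubini_F/= ge0_integralZl.
Qed.

(** Independence, for products: peel off the first coordinate. *)
Lemma integral_prod_paths (h : X -> \bar R) n :
  measurable_fun [set: _] h -> (forall x, 0 <= h x) ->
  \int[Q]_s (\prod_(i < n) h (s i)) = (\int[nu]_x h x) ^+ n.
Proof.
move=> mh h0.
have mp m : measurable_fun [set: paths X] (fun s : paths X => \prod_(i < m) h (s i)).
  apply: (@measurable_prode _ _ (paths X) m (fun i (s : paths X) => h (s i))) => i.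
  exact: (measurableT_comp mh (measurable_coord i)).
elim: n => [|n IH].
  under eq_integral do rewrite big_ord0.
  by rewrite integral_probability_cst expe0.
rewrite ge0_integral_cons_path//; last by move=> s; exact: prode_ge0.
under eq_integral do rewrite big_ord_recl /=.
rewrite (@ge0_integral_fstMsnd _ (fun s => \prod_(i < n) h (s i)))//.
  by rewrite IH expeS.
by move=> s; exact: prode_ge0.
Qed.

Lemma coord_law (B : set X) (i : nat) : measurable B ->
  Q [set s | B (s i)] = nu B.
Proof.
move=> mB; have mC j : measurable ([set s | B (s j)] : set (paths X)).
  by rewrite -[X in measurable X]setTI; exact: measurable_coord.
elim: i => [|i IH]; rewrite QE//.
  rewrite (_ : _ @^-1` _ = B `*` [set: paths X]).
    by rewrite product_probability1E// probability_setT mule1.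
  by apply/seteqP; split => -[x s] //= [].
rewrite (_ : _ @^-1` _ = [set: X] `*` [set s : paths X | B (s i)]).
  by rewrite product_probability1E// probability_setT mul1e.
by apply/seteqP; split => -[x s] //= [].
Qed.

Lemma ae_coord (G : set X) :
  {ae nu, forall x, G x} -> {ae Q, forall s : paths X, forall i, G (s i)}.
Proof.
move=> [N [mN N0 GN]]; apply: ae_foralln => i.
exists [set s : paths X | N (s i)]; split => //.
- by rewrite -[X in measurable X]setTI; exact: measurable_coord.
- by rewrite -N0; exact: coord_law.
- by move=> s /= h; exact: GN.
Qed.

End iid_integral.

(** * Random walks with negative drift are bounded above *)

Section walk.
Context {R : realType} {d : measure_display} {X : measurableType d}.
Variables a b : X -> \bar R.

(** The largest of the partial sums [S_0 = 0, S_1, ..., S_n] of the walk with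
    steps [a (s i) - b (s i)]. Peeling the first step gives the recursion
    [max (0, a - b + (maximum for the shifted path))], which only involves an
    independent head and a tail with the same law. The increment is kept as a
    difference of nonnegative extended reals, so that all integrals make sense
    even when [b] has infinite mean. *)
Fixpoint walk_max (n : nat) (s : paths X) : \bar R :=
  if n is m.+1
  then maxe 0 (walk_max m (fun i => s i.+1) + a (s 0%N) - b (s 0%N)) else 0.

Lemma walk_max_cons n (z : X * paths X) :
  walk_max n.+1 (cons_path z) = maxe 0 (walk_max n z.2 + a z.1 - b z.1).
Proof. by []. Qed.

Lemma walk_max_ge0 n s : 0 <= walk_max n s.
Proof. by case: n => [|n] //=; rewrite le_max lexx. Qed.

Lemma walk_max_nd s : {homo walk_max^~ s : n m / (n <= m)%N >-> n <= m}.
Proof.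
apply/nondecreasing_seqP => n; elim: n s => [|n IH] s.
  exact: (walk_max_ge0 1).
apply: le_max2 => //; apply: leeD => //; apply: leeD => //; exact: IH.
Qed.

Hypothesis a0 : forall x, 0 <= a x.
Hypothesis b0 : forall x, 0 <= b x.
Hypothesis ma : measurable_fun [set: X] a.
Hypothesis mb : measurable_fun [set: X] b.

Lemma walk_max_cons_le n (z : X * paths X) :
  walk_max n.+1 (cons_path z) <= walk_max n z.2 + a z.1.
Proof.
rewrite walk_max_cons ge_max adde_ge0 ?walk_max_ge0//=.
by rewrite -[leRHS]adde0 leeD// oppe_le0.
Qed.

(** The recursion [N' = max (0, N + a - b)] as an identity between nonnegative
    terms: [N' + min (b, N + a) = N + a]. It can be integrated without
    worrying about [+oo - oo]. *)
Lemma walk_max_balance n (z : X * paths X) :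
  walk_max n.+1 (cons_path z) + mine (b z.1) (walk_max n z.2 + a z.1) =
  walk_max n z.2 + a z.1.
Proof.
rewrite walk_max_cons.
have : 0 <= walk_max n z.2 + a z.1 by rewrite adde_ge0 ?walk_max_ge0.
have := b0 z.1; move: (b z.1) (_ + _) => [r| |] [N| |]//; rewrite ?lee_fin => r0 N0.
- have [rN|Nr] := leP r N.
    rewrite max_r ?lee_fin ?subr_ge0// min_l ?lee_fin//.
    by rewrite -EFinB -EFinD subrK.
  rewrite max_l ?lee_fin ?subr_le0 1?ltW//.
  by rewrite min_r ?lee_fin 1?ltW// add0e.
- by rewrite /= max_r ?leey// min_l ?leey.
- by rewrite /= max_l// min_r ?leey// add0e.
Qed.

Lemma measurable_walk_max n : measurable_fun [set: _] (walk_max n).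
Proof.
elim: n => [|n IH]; first exact: measurable_cst.
apply: measurable_maxe; first exact: measurable_cst.
apply: emeasurable_funB; last first.
  exact: (measurableT_comp mb (measurable_coord 0%N)).
apply: emeasurable_funD; last first.
  exact: (measurableT_comp ma (measurable_coord 0%N)).
have mshift : measurable_fun [set: paths X]
    (fun s : paths X => (fun i => s i.+1) : paths X).
  by apply: measurable_to_paths => i; exact: measurable_coord.
exact: (measurableT_comp IH mshift).
Qed.

Definition walk_sup (s : paths X) := ereal_sup (range (walk_max^~ s)).

Lemma walk_max_le_sup n s : walk_max n s <= walk_sup s.
Proof. by apply: ereal_sup_ubound; exists n. Qed.

Lemma walk_max_cvg s : walk_max n s @[n --> \oo] --> walk_sup s.
Proof. exact: ereal_nondecreasing_cvgn (walk_max_nd s). Qed.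

Lemma measurable_walk_sup : measurable_fun [set: _] walk_sup.
Proof.
apply: (emeasurable_fun_cvg walk_max); first exact: measurable_walk_max.
by move=> s _; exact: walk_max_cvg.
Qed.

(** If the supremum is infinite for a path, it is infinite for its tail as soon
    as the head has finite [a]: divergence is a shift-invariant event in the
    direction needed below. *)
Lemma walk_sup_cons_le (z : X * paths X) :
  walk_sup (cons_path z) <= walk_sup z.2 + a z.1.
Proof.
apply: ub_ereal_sup => _ [[|n] _ <-].
  by rewrite adde_ge0// (le_trans (walk_max_ge0 0 z.2))// walk_max_le_sup.
by rewrite (le_trans (walk_max_cons_le _ _))// leeD// walk_max_le_sup.
Qed.

Variables (nu : probability X R) (Q : probability (paths X) R).
Hypothesis QE : iid_law nu Q.
Hypothesis ab : \int[nu]_x a x < \int[nu]_x b x.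

Let A := [set s | walk_sup s = +oo].

Let mA : measurable A.
Proof.
rewrite (_ : A = [set: _] `&` walk_sup @^-1` [set +oo]); last by rewrite setTI.
by apply: measurable_walk_sup.
Qed.

Let chi (s : paths X) : \bar R := (\1_A s)%:E.

Let chi0 s : 0 <= chi s. Proof. by rewrite lee_fin. Qed.

Let mchi : measurable_fun [set: _] chi.
Proof. by apply/measurable_EFinP; exact: measurable_indic. Qed.

Let int_chi : \int[Q]_s chi s = Q A.
Proof. by rewrite integral_indic// setIT. Qed.

Let int_a_fin : \int[nu]_x a x \is a fin_num.
Proof. by rewrite ge0_fin_numE ?integral_ge0// (lt_le_trans ab)// leey. Qed.

Let mN n : measurable_fun [set: X * paths X] (fun z => walk_max n z.2).
Proof. exact: measurableT_comp (measurable_walk_max n) measurable_snd. Qed.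

Let mNc n : measurable_fun [set: X * paths X] (fun z => walk_max n (cons_path z)).
Proof.
exact: measurableT_comp (measurable_walk_max n) (@measurable_cons_path _ X).
Qed.

Let ma1 : measurable_fun [set: X * paths X] (fun z => a z.1).
Proof. exact: measurableT_comp ma measurable_fst. Qed.

Let mb1 : measurable_fun [set: X * paths X] (fun z => b z.1).
Proof. exact: measurableT_comp mb measurable_fst. Qed.

Let mchi2 : measurable_fun [set: X * paths X] (fun z => chi z.2).
Proof. exact: measurableT_comp mchi measurable_snd. Qed.

Let mchic : measurable_fun [set: X * paths X] (fun z => chi (cons_path z)).
Proof. exact: measurableT_comp mchi (@measurable_cons_path _ X). Qed.

Let int_walk_max_fin n : \int[Q]_s walk_max n s < +oo.
Proof.
elim: n => [|n IH]; first by rewrite integral0.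
rewrite (ge0_integral_cons_path QE); last 2 first.
- exact: measurable_walk_max.
- by move=> s; exact: walk_max_ge0.
apply: (@le_lt_trans _ _ (\int[(nu \x Q)]_z (walk_max n z.2 + a z.1))).
  apply: ge0_le_integral => //.
  - by move=> z _; exact: walk_max_ge0.
  - exact: emeasurable_funD.
  - by move=> z _; exact: walk_max_cons_le.
rewrite ge0_integralD//; last by move=> z _; exact: walk_max_ge0.
rewrite ge0_integral_snd//; last 2 first.
- exact: measurable_walk_max.
- by move=> s; exact: walk_max_ge0.
rewrite ge0_integral_fst// lte_add_pinfty//.
by rewrite -ge0_fin_numE// integral_ge0.
Qed.

(* [I], [J] and [K] are the three terms of [walk_max_balance] integrated over
   the event that the tail diverges. *)
Let I n := \int[Q]_s (walk_max n s * chi s).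

Let I_fin n : I n \is a fin_num.
Proof.
rewrite ge0_fin_numE; last first.
  by apply: integral_ge0 => s _; rewrite mule_ge0 ?walk_max_ge0.
apply: le_lt_trans (int_walk_max_fin n).
apply: ge0_le_integral => //.
- by move=> s _; rewrite mule_ge0 ?walk_max_ge0.
- by apply: emeasurable_funM => //; exact: measurable_walk_max.
- exact: measurable_walk_max.
- move=> s _; rewrite -[leRHS]mule1 lee_wpmul2l ?walk_max_ge0//.
  by rewrite lee_fin indicE; case: (_ \in _).
Qed.

Let J n := \int[(nu \x Q)]_z (walk_max n.+1 (cons_path z) * chi z.2).

(* Shift invariance of [A] and monotonicity of the maxima. *)
Let I_le_J n : I n <= J n.
Proof.
apply: (@le_trans _ _ (I n.+1)).
  apply: ge0_le_integral => //.
  - by move=> s _; rewrite mule_ge0 ?walk_max_ge0.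
  - by apply: emeasurable_funM => //; exact: measurable_walk_max.
  - by apply: emeasurable_funM => //; exact: measurable_walk_max.
  - by move=> s _; rewrite lee_wpmul2r// walk_max_nd.
rewrite /I (ge0_integral_cons_path QE); last 2 first.
- by apply: emeasurable_funM => //; exact: measurable_walk_max.
- by move=> s; rewrite mule_ge0 ?walk_max_ge0.
apply: ae_ge0_le_integral => //.
- by move=> z _; rewrite mule_ge0 ?walk_max_ge0.
- exact: emeasurable_funM.
- by move=> z _; rewrite mule_ge0 ?walk_max_ge0.
- exact: emeasurable_funM.
(* [a] is integrable, so almost every head has finite [a]. *)
have [N [mN' N0 aN]] : {ae nu, forall x, a x < +oo}.
  have /(integrable_ae measurableT) : nu.-integrable [set: X] a.
    apply/integrableP; split => //.
    under eq_integral => x _ do rewrite gee0_abs//.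
    by rewrite -ge0_fin_numE ?integral_ge0.
  by apply: filterS => x /(_ Logic.I); rewrite ge0_fin_numE.
exists (N `*` [set: paths X]); split; first exact: measurableX.
  by apply: etrans (product_probability1E nu Q mN' measurableT) _; rewrite N0 mul0e.
move=> z /=; apply: contra_notP => Nz _.
have az : a z.1 < +oo by apply: contrapT => h; apply: Nz; split => //; exact: aN.
apply: lee_wpmul2l; first exact: (walk_max_ge0 n.+1 (cons_path z)).
rewrite /chi lee_fin !indicE.
have [cA|_] := boolP (cons_path z \in A); last by case: (_ \in _).
rewrite (_ : z.2 \in A)//; move: cA; rewrite !inE /A /= => cA.
have := walk_sup_cons_le z; rewrite cA leye_eq.
have : 0 <= walk_sup z.2 by exact: le_trans (walk_max_ge0 0 z.2) (walk_max_le_sup _ _).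
move: az (a0 z.1).
by case: (a z.1) => [r| |]//; case: (walk_sup z.2).
Qed.

Let K n := \int[(nu \x Q)]_z
  (mine (b z.1) (walk_max n z.2 + a z.1) * chi z.2).

Let mKn n : measurable_fun [set: X * paths X]
  (fun z => mine (b z.1) (walk_max n z.2 + a z.1) * chi z.2).
Proof.
apply: emeasurable_funM => //; apply: measurable_mine => //.
exact: emeasurable_funD.
Qed.

Let Kn_ge0 n (z : X * paths X) :
  0 <= mine (b z.1) (walk_max n z.2 + a z.1) * chi z.2.
Proof. by rewrite mule_ge0// le_min b0 adde_ge0// walk_max_ge0. Qed.

Let JK n : J n + K n = I n + (\int[nu]_x a x) * Q A.
Proof.
have N0 m s : 0 <= walk_max m s by exact: walk_max_ge0.
rewrite /J /K -ge0_integralD//; last 2 first.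
- by move=> z _; rewrite mule_ge0.
- exact: emeasurable_funM.
transitivity (\int[(nu \x Q)]_z (walk_max n z.2 * chi z.2 + a z.1 * chi z.2)).
  apply: eq_integral => z _; rewrite -ge0_muleDl//; last first.
    by rewrite le_min b0 adde_ge0.
  by rewrite walk_max_balance ge0_muleDl.
rewrite ge0_integralD//.
- rewrite (@ge0_integral_snd _ _ _ nu Q (fun s => walk_max n s * chi s)).
  + by rewrite ge0_integral_fstMsnd// int_chi.
  + by apply: emeasurable_funM => //; exact: measurable_walk_max.
  + by move=> s; rewrite mule_ge0.
- by move=> z _; rewrite mule_ge0.
- exact: emeasurable_funM.
- by move=> z _; rewrite mule_ge0.
- exact: emeasurable_funM.
Qed.

Let K_le n : K n <= (\int[nu]_x a x) * Q A.
Proof. by rewrite -(@leeD2lE _ (I n))// -JK leeD. Qed.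

(* On the divergence event [walk_max n] tends to [+oo], hence the minimum tends
   to [b]. *)
Let K_cvg : K n @[n --> \oo] --> (\int[nu]_x b x) * Q A.
Proof.
rewrite -int_chi -ge0_integral_fstMsnd//.
have := @cvg_monotone_convergence _ _ _ (nu \x Q)%E setT measurableT
  (fun n z => mine (b z.1) (walk_max n z.2 + a z.1) * chi z.2) mKn
  (fun n z _ => Kn_ge0 n z).
rewrite (_ : \int[_]_(z in _) (fun _ => limn _) z =
    \int[(nu \x Q)]_z (b z.1 * chi z.2)); first apply.
  move=> z _ n m nm; rewrite lee_wpmul2r// le_min2// leeD//.
  exact: walk_max_nd.
apply: eq_integral => z _; apply: cvg_lim => //.
rewrite /chi indicE; have [|_] := boolP (z.2 \in A); last first.
  by under eq_fun do rewrite mule0; rewrite mule0; exact: cvg_cst.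
rewrite inE /A /= => Az.
under eq_fun do rewrite mule1.
rewrite mule1.
have Noo : walk_max n z.2 + a z.1 @[n --> \oo] --> +oo.
  apply: gee_cvgy; last by rewrite -Az; exact: walk_max_cvg.
  by apply: nearW => n; rewrite leeDl.
have := b0 z.1; case: (b z.1) => [r _| _|//].
  apply: cvg_near_cst; near=> n; rewrite min_l//; near: n.
  exact: cvgey_ge.
apply: gee_cvgy Noo; apply: nearW => n.
by rewrite min_r ?leey.
Unshelve. all: by end_near. Qed.

(** Let [A] be the event that the walk is unbounded above. Integrating
    [walk_max_balance] over [A] (for the tail), the mass of [walk_max n] on [A]
    is finite and nondecreasing in [n], so the mass of [min (b, N + a)] is at
    most that of [a]. As [n] grows the former tends to the mass of [b], and the
    head is independent of the tail: [E b * Q A <= E a * Q A]. With [E a < E b]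
    this forces [Q A = 0]. This maximal-inequality argument plays the part of
    one half of the strong law of large numbers, and only needs a mean in
    the extended sense. *)
Theorem walk_sup_fin : {ae Q, forall s, walk_sup s < +oo}.
Proof.
have bQ : (\int[nu]_x b x) * Q A <= (\int[nu]_x a x) * Q A.
  rewrite -(cvg_lim _ K_cvg)//; apply: lime_le.
    by apply/cvg_ex; eexists; exact: K_cvg.
  exact: nearW.
exists A; split => //; last first.
  by move=> s /= /negP; rewrite -leNgt leye_eq => /eqP.
apply/eqP; apply: contraTT bQ => QA0; rewrite -ltNge lte_pmul2r//.
- exact: fin_num_measure.
- by rewrite lt0e QA0/=.
Qed.

End walk.

(** * Exponential growth of products *)

Lemma cvgy_expR_nat {R : realType} (K k : R) : (0 < K)%R -> (0 < k)%R ->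
  (K * expR (k * n%:R))%:E @[n --> \oo] --> +oo.
Proof.
move=> K0 k0; apply/cvgeryP.
have h : ((K * k) * n%:R)%R @[n --> \oo] --> (+oo)%R.
  apply/cvgryPge => A; have /cvgryPge/(_ (A / (K * k))%R) := @cvgr_idn R.
  by apply: filterS => n; rewrite ler_pdivrMr ?mulr_gt0// mulrC.
apply: ger_cvgy h; apply: nearW => n; rewrite -mulrA ler_pM2l//.
by apply: le_trans (expR_ge1Dx _); rewrite lerDr.
Qed.

Lemma prode_gt0 {R : realType} (n : nat) (g : nat -> \bar R) :
  (forall i, 0 < g i) -> 0 < \prod_(i < n) g i.
Proof.
move=> g0; elim: n => [|n IH]; first by rewrite big_ord0.
by rewrite big_ord_recr/= mule_gt0.
Qed.

Section growth.
Context {R : realType} {d : measure_display} {X : measurableType d}.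
Variables (nu : probability X R) (Q : probability (paths X) R).
Hypothesis QE : iid_law nu Q.

(** The product of the [Z (s i)] is the exponential of minus the walk with steps
    [c1 - lne (Z (s i))], up to the factor [expR (c1 * n)]. The constant [c1] is
    split as [u - v] so that it can be absorbed into the nonnegative parts of
    the steps. Positivity of every [Z (s i)] excludes the products [0 * +oo]. *)
Lemma walk_max_prode (Z : X -> \bar R) (c1 u v : R) n (s : paths X) :
    (forall i, 0 < Z (s i)) -> (u - v)%R = c1 ->
  expeR (- walk_max (fun x => (@lne R \o Z)^\- x + u%:E)
                    (fun x => (@lne R \o Z)^\+ x + v%:E) n s)
    * (expR (c1 * n%:R))%:E <= \prod_(i < n) Z (s i).
Proof.
move=> + uv; elim: n s => [|n IH] s Z0.
  by rewrite big_ord0 /= !oppr0 mulr0 !expR0 mule1.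
rewrite big_ord_recl /=.
have := IH _ (fun i => Z0 i.+1).
have := walk_max_ge0 (fun x => (@lne R \o Z)^\- x + u%:E)
  (fun x => (@lne R \o Z)^\+ x + v%:E) n (fun i => s i.+1).
have := @prode_gt0 _ n (fun i => Z (s i.+1)) (fun i => Z0 i.+1).
move: (walk_max _ _ _ _) (\prod_(i < n) _) => t p p0 t0 tp.
have := Z0 0%N; rewrite funenegE funeposE /=.
case: (Z (s 0%N)) => [r r0| _|//]; last by rewrite gt0_mulye ?leey.
have {}r0 : (0 < r)%R by [].
rewrite lne_EFin//; set l := ln r.
case: t t0 tp => [t| |//] t0 tp; last first.
  rewrite -EFinN -!EFin_max -!EFinD /= (max_r (leey 0)) /= mul0e.
  by rewrite mule_ge0// ltW.
rewrite -EFinN -!EFin_max /=.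
case: p p0 tp => [p| |//] p0 tp; last by rewrite gt0_muley ?leey.
move: tp; rewrite -!EFinM !lee_fin => tp.
apply: (@le_trans _ _ (r * (expR (- t) * expR (c1 * n%:R)))%R); last first.
  by rewrite ler_pM2l.
have -> : r = expR l by rewrite lnK.
rewrite -!expRD ler_expR.
have : (t + (Num.max (- l) 0 + u) - (Num.max l 0 + v) = t + c1 - l)%R.
  by rewrite -uv; case: (leP l 0%R) => l0; case: (leP (-l)%R 0%R) => l1; lra.
move=> ->.
have : (t + c1 - l <= Num.max 0 (t + c1 - l))%R by rewrite le_max lexx orbT.
rewrite -(natr1 n) mulrDr mulr1; lra.
Qed.

Lemma integral_lne_gt (Z : X -> \bar R) (c1 u v : R) :
    measurable_fun [set: X] Z -> (0 <= u)%R -> (0 <= v)%R -> (u - v)%R = c1 ->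
    c1%:E < \int[nu]_x lne (Z x) ->
  \int[nu]_x ((@lne R \o Z)^\- x + u%:E) < \int[nu]_x ((@lne R \o Z)^\+ x + v%:E).
Proof.
move=> mZ u0 v0 uv; rewrite integralE.
have mlZ : measurable_fun [set: X] (@lne R \o Z) by exact: measurable_lne.
rewrite !ge0_integralD//; last 2 first.
- exact: measurable_funepos.
- exact: measurable_funeneg.
rewrite !integral_probability_cst.
have : 0 <= \int[nu]_x (@lne R \o Z)^\- x by exact: integral_ge0.
have : 0 <= \int[nu]_x (@lne R \o Z)^\+ x by exact: integral_ge0.
move: (\int[nu]_x (@lne R \o Z)^\- x) (\int[nu]_x (@lne R \o Z)^\+ x).
case=> [m| |//] [p| |//] p0 m0; rewrite ?ltry// -?EFinB -?EFinD ?lte_fin.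
lra.
Qed.

(** A value [Z x = 0] contributes [-oo] to the mean of [lne Z]. *)
Lemma ae_gt0_of_lne (Z : X -> \bar R) (c1 : R) :
    measurable_fun [set: X] Z -> c1%:E < \int[nu]_x lne (Z x) ->
  {ae nu, forall x, 0 < Z x}.
Proof.
move=> mZ; rewrite integralE => lc.
have mlZ : measurable_fun [set: X] (@lne R \o Z) by exact: measurable_lne.
have : \int[nu]_x (@lne R \o Z)^\- x < +oo.
  rewrite ltey; apply: contraTN lc => /eqP ->.
  by rewrite addeNy -leNgt leNye.
have mn := measurable_funeneg mlZ.
move=> hfin; have /(integrable_ae measurableT) :
    nu.-integrable [set: X] (@lne R \o Z)^\-.
  apply/integrableP; split => //.
  by under eq_integral => x _ do rewrite gee0_abs//.
apply: filterS => x /(_ Logic.I); apply: contraTT; rewrite -leNgt => Z0.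
by rewrite funenegE/= le0_lneNy//= maxye.
Qed.

(** If the mean of [lne Z] exceeds [c0] then the product of the first [n] values
    of [Z] eventually dominates [expR (c0 * n)]. Take [c1] strictly between:
    the walk with steps [c1 - lne Z] has negative drift, hence is bounded above
    by [walk_sup_fin], and the product is at least a constant times
    [expR (c1 * n)]. *)
Theorem product_growth (Z : X -> \bar R) (c0 : R) :
    measurable_fun [set: X] Z -> c0%:E < \int[nu]_x lne (Z x) ->
  {ae Q, forall s : paths X, (expR (- c0 * n%:R))%:E * \prod_(i < n) Z (s i)
                     @[n --> \oo] --> +oo}.
Proof.
move=> mZ cZ.
have [c1 cc1 c1Z] : exists2 c1 : R, (c0 < c1)%R & c1%:E < \int[nu]_x lne (Z x).
  move: cZ; case: (\int[nu]_x lne (Z x)) => [r| |//]; last first.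
    by move=> _; exists (c0 + 1)%R; rewrite ?ltry// ltrDl.
  by rewrite lte_fin => cr; exists ((c0 + r) / 2)%R; rewrite ?lte_fin; lra.
pose u := Num.max c1 0%R; pose v := Num.max (- c1)%R 0%R.
have u0 : (0 <= u)%R by rewrite le_max lexx orbT.
have v0 : (0 <= v)%R by rewrite le_max lexx orbT.
have uv : (u - v)%R = c1.
  by rewrite /u /v; case: (leP c1 0)%R => h1; case: (leP (- c1) 0)%R => h2; lra.
have mlZ : measurable_fun [set: X] (@lne R \o Z) by exact: measurable_lne.
have h1 := ae_coord QE (ae_gt0_of_lne mZ c1Z).
have h2 : {ae Q, forall s, walk_sup (fun x => (@lne R \o Z)^\- x + u%:E)
    (fun x => (@lne R \o Z)^\+ x + v%:E) s < +oo}.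
  apply: (walk_sup_fin _ _ _ _ QE (integral_lne_gt mZ u0 v0 uv c1Z)).
  - by move=> x; rewrite adde_ge0.
  - by move=> x; rewrite adde_ge0.
  - by apply: emeasurable_funD => //; exact: measurable_funeneg.
  - by apply: emeasurable_funD => //; exact: measurable_funepos.
move: h1 h2; apply: filterS2 => s Z0 sfin.
have [M Mle] : exists M : R, forall n, walk_max
    (fun x => (@lne R \o Z)^\- x + u%:E)
    (fun x => (@lne R \o Z)^\+ x + v%:E) n s <= M%:E.
  move: sfin (walk_max_le_sup (fun x => (@lne R \o Z)^\- x + u%:E)
    (fun x => (@lne R \o Z)^\+ x + v%:E) ^~ s).
  case: (walk_sup _ _ s) => [M| |] // _ h; first by exists M.
  by exists 0%R => n; rewrite (le_trans (h n))// leNye.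
apply: (@gee_cvgy _ _ _ _ (fun n => (expR (- M) * expR ((c1 - c0) * n%:R))%:E)).
  apply: nearW => n.
  have : (expR (- M))%:E * (expR (c1 * n%:R))%:E <= \prod_(i < n) Z (s i).
    apply: le_trans (walk_max_prode n Z0 uv).
    apply: lee_wpmul2r; first by rewrite lee_fin expR_ge0.
    by rewrite -[leLHS]/(expeR (- M%:E)) lee_expeR leeN2.
  rewrite -(@lee_pmul2l _ (expR (- c0 * n%:R))%:E) ?fin_numE//; last first.
    by rewrite lte_fin expR_gt0.
  apply: le_trans; rewrite -!EFinM lee_fin le_eqVlt; apply/orP; left.
  by apply/eqP; rewrite -!expRD; congr expR; lra.
apply: cvgy_expR_nat; [exact: expR_gt0|by rewrite subr_gt0].
Qed.

End growth.

(** * Integrated products *)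

Lemma ae_swap {R : realType} d1 d2 (T1 : measurableType d1)
    (T2 : measurableType d2) (P1 : probability T1 R) (P2 : probability T2 R)
    (B : set (T1 * T2)) : measurable B ->
  (forall x, {ae P2, forall y, B (x, y)}) ->
  {ae P2, forall y, {ae P1, forall x, B (x, y)}}.
Proof.
move=> mB BP2; have mC := measurableC mB.
have sec0 : \int[P2]_y `|(P1 \o ysection (~` B)) y| = 0.
  under eq_integral do rewrite gee0_abs//.
  transitivity (\int[P1]_x (P2 \o xsection (~` B)) x).
    by rewrite -indic_fubini_tonelli_FE// -indic_fubini_tonelli_GE//
       indic_fubini_tonelli.
  rewrite integral0_eq// => x _ /=.
  apply: measure_negligible; first exact: measurable_xsection.
  by apply: negligibleS (BP2 x) => y; rewrite /xsection/= inE.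
have /(ae_eq_integral_abs _ measurableT) :=
  measurable_fun_ysection P1 mC.
move=> /(_ P2) /iffLR/(_ sec0).
apply: filterS => y /(_ Logic.I) /= y0.
exists (ysection (~` B) y); split => //; first exact: measurable_ysection.
by move=> x; rewrite /ysection/= inE.
Qed.

Lemma measurable_limn_einf {R : realType} d (T : measurableType d)
    (u : nat -> T -> \bar R) : (forall n, measurable_fun [set: T] (u n)) ->
  measurable_fun [set: T] (fun t => limn_einf (u^~ t)).
Proof.
move=> mu_.
rewrite (_ : (fun t => _) = fun t => - limn_esup (fun n => - u n t)).
  by apply: measurableT_comp => //; apply: measurable_fun_limn_esup => n;
    exact: measurableT_comp.
by apply/funext => t; rewrite limn_esupN oppeK.
Qed.

Lemma limn_einf_cvgy {R : realType} (u : nat -> \bar R) :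
  limn_einf u = +oo -> u n @[n --> \oo] --> +oo.
Proof.
move=> uoo; apply: (@gee_cvgy _ _ _ _ (einfs u)).
  apply: nearW => n; apply: ereal_inf_lbound; exists n => //=.
by rewrite -uoo limn_einf_lim; exact: is_cvg_einfs.
Qed.

Section parameter.
Context {R : realType} {d dT : measure_display} {X : measurableType d}
  {T : measurableType dT}.
Variables (nu : probability X R) (Q : probability (paths X) R).
Variable (Pi : probability T R).
Hypothesis QE : iid_law nu Q.
Variable Z : T * X -> \bar R.
Hypothesis mZ : measurable_fun [set: T * X] Z.
Hypothesis Z0 : forall z, 0 <= Z z.

Lemma measurable_coord_pair (i : nat) :
  measurable_fun [set: T * paths X] (fun z => Z (z.1, z.2 i)).
Proof.
apply: (measurableT_comp mZ); apply: measurable_fun_pair => //.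
exact: measurableT_comp (measurable_coord i) measurable_snd.
Qed.

Lemma measurable_prod_pair n :
  measurable_fun [set: T * paths X] (fun z => \prod_(i < n) Z (z.1, z.2 i)).
Proof.
apply: (@measurable_prode _ _ _ n (fun i (z : T * paths X) => Z (z.1, z.2 i))).
exact: measurable_coord_pair.
Qed.

(** By [product_growth] each parameter of [V] has, for almost every path, a
    product that beats [expR (c0 * n)]; by Fubini almost every path has this
    property for almost all parameters of [V], and Fatou's lemma passes to the
    integral. *)
Lemma integral_prod_growth (V : set T) (c0 : R) : measurable V -> 0 < Pi V ->
  (forall t, V t -> c0%:E < \int[nu]_x lne (Z (t, x))) ->
  {ae Q, forall s : paths X,
    (expR (- c0 * n%:R))%:E * \int[Pi]_(t in V) (\prod_(i < n) Z (t, s i))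
      @[n --> \oo] --> +oo}.
Proof.
move=> mV V0 cZ.
pose F n (z : T * paths X) :=
  (expR (- c0 * n%:R))%:E * \prod_(i < n) Z (z.1, z.2 i).
have mF n : measurable_fun [set: T * paths X] (F n).
  by apply: measurable_funeM; exact: measurable_prod_pair.
have F0 n z : 0 <= F n z.
  by apply: mule_ge0; [rewrite lee_fin expR_ge0|exact: prode_ge0].
pose G z := limn_einf (F^~ z).
have mG : measurable_fun [set: T * paths X] G by exact: measurable_limn_einf.
have mB : measurable [set z : T * paths X | V z.1 -> G z = +oo].
  rewrite (_ : [set z | _] = (~` (V `*` setT)) `|` G @^-1` [set +oo]).
    apply: measurableU; first by apply: measurableC; exact: measurableX.
    by rewrite -[X in measurable X]setTI; exact: mG.
  apply/seteqP; split => z /=.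
    by move=> h; have [Vz|nVz] := pselect (V z.1); [right; exact: h|left => -[]].
  by move=> [nVz Vz|//]; exfalso; apply: nVz.
have aeB t : {ae Q, forall s, V t -> G (t, s) = +oo}.
  have [Vt|nVt] := pselect (V t); last by apply: aeW => s /nVt.
  have := product_growth QE (measurable_fun_pair2 t mZ) (cZ t Vt).
  apply: filterS => s h _; rewrite /G /F /=.
  by have [-> _] := cvg_limn_einf_sup h.
have := ae_swap Pi mB aeB.
apply: filterS => s sB.
have mFs n : measurable_fun [set: T] (fun t => F n (t, s)).
  exact: measurable_fun_pair1.
rewrite (_ : (fun n => _) = fun n => \int[Pi]_(t in V) F n (t, s)); last first.
  apply/funext => n; rewrite /F ge0_integralZl_EFin ?expR_ge0//.
  - by move=> t _; exact: prode_ge0.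
  - apply: (@measurable_funS _ _ _ _ setT) => //.
    exact: (measurable_fun_pair1 s (measurable_prod_pair n)).
apply: limn_einf_cvgy; apply/eqP; rewrite -leye_eq.
apply: (@le_trans _ _ (\int[Pi]_(t in V) limn_einf (fun n => F n (t, s)))).
  rewrite (@ae_eq_integral _ _ _ Pi V (cst +oo))//.
  - by rewrite integral_cst// gt0_mulye.
  - apply: (@measurable_funS _ _ _ _ setT) => //.
    exact: (measurable_fun_pair1 s mG).
apply: (@fatou _ _ _ Pi V mV (fun n t => F n (t, s))) => // n.
exact: (@measurable_funS _ _ _ _ setT).
Qed.

(** The mean of the integrated product is at most [expR (g * n)] by independence.
    Divided by [expR (g' * n)] these means are summable, so the sum over [n] of
    the normalised integrals is almost surely finite, and bounds each term. *)
Lemma integral_prod_bound (A : set T) (g g' : R) : measurable A -> (g < g')%R ->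
  (forall t, A t -> \int[nu]_x Z (t, x) <= (expR g)%:E) ->
  {ae Q, forall s : paths X, exists M : R, forall n,
    \int[Pi]_(t in A) (\prod_(i < n) Z (t, s i)) <= (M * expR (g' * n%:R))%:E}.
Proof.
move=> mA gg' Zg.
(* The indicator turns the integral over [A] into one over the whole space, as
   the Fubini theorem expects. *)
pose H n (z : T * paths X) := (\1_A z.1)%:E * \prod_(i < n) Z (z.1, z.2 i).
have prod0 n (z : T * paths X) : 0 <= \prod_(i < n) Z (z.1, z.2 i) :> \bar R.
  exact: prode_ge0.
have mH n : measurable_fun [set: T * paths X] (H n).
  apply: emeasurable_funM; last exact: measurable_prod_pair.
  apply/measurable_EFinP; apply: measurableT_comp => //.
have H0 n z : 0 <= H n z by apply: mule_ge0; [rewrite lee_fin|exact: prod0].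
pose J n (s : paths X) := \int[Pi]_t H n (t, s).
have JE n (s : paths X) : \int[Pi]_(t in A) (\prod_(i < n) Z (t, s i)) = J n s.
  rewrite integral_mkcond epatch_indic; apply: eq_integral => t _ /=.
  by rewrite muleC.
have mJ n : measurable_fun [set: paths X] (J n).
  exact: (measurable_fun_fubini_tonelli_G (H n)).
have J0 n s : 0 <= J n s by exact: integral_ge0.
have intJ n : \int[Q]_s J n s <= (expR (g * n%:R))%:E.
  rewrite -(fubini_tonelli (H n))//.
  rewrite -[leRHS](integral_probability_cst Pi).
  apply: ge0_le_integral => //.
  - by move=> t _; exact: integral_ge0.
  - exact: (measurable_fun_fubini_tonelli_F (H n)).
  move=> t _; rewrite /fubini_F /H /=.
  rewrite ge0_integralZl//; last 2 first.
  - exact: (measurable_fun_pair2 t (measurable_prod_pair n)).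
  - by move=> s _; exact: prode_ge0.
  have [At|nAt] := pselect (A t); last first.
    by rewrite indicE memNset// mul0e lee_fin expR_ge0.
  rewrite indicE mem_set// mul1e.
  rewrite (integral_prod_paths QE n (measurable_fun_pair2 t mZ))//.
  rewrite expRM_natr; elim: {mH H0 JE mJ J0} n => [|n IH].
    by rewrite expe0 expr0.
  rewrite expeS exprS EFinM lee_pmul//; first exact: integral_ge0.
    by apply: expe_ge0; exact: integral_ge0.
  exact: Zg.
pose q := expR (g - g').
have q1 : (q < 1)%R by rewrite -expR0 ltr_expR subr_lt0.
pose u n s := (expR (- g' * n%:R))%:E * J n s.
have mu_ n : measurable_fun [set: paths X] (u n) by exact: measurable_funeM.
have u0 n s : 0 <= u n s by apply: mule_ge0 => //; rewrite lee_fin expR_ge0.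
have intu n : \int[Q]_s u n s <= (q ^+ n)%:E.
  rewrite ge0_integralZl//.
  apply: (@le_trans _ _ ((expR (- g' * n%:R))%:E * (expR (g * n%:R))%:E)).
    by apply: lee_wpmul2l => //; rewrite lee_fin expR_ge0.
  by rewrite -EFinM lee_fin -expRD -expRM_natr -mulrDl addrC.
(* The means of the [u n] are dominated by a geometric series. *)
pose S s := \sum_(0 <= n <oo) u n s.
have S0 s : 0 <= S s by exact: nneseries_ge0.
have mS : measurable_fun [set: paths X] S.
  exact: ge0_emeasurable_sum.
have intS : \int[Q]_s S s < +oo.
  rewrite integral_nneseries//.
  apply: (@le_lt_trans _ _ (1 / (1 - q))%:E); last exact: ltry.
  apply: lime_le.
    by apply: is_cvg_nneseries => n _ _; exact: integral_ge0.
  apply: nearW => n.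
  apply: (@le_trans _ _ (\sum_(0 <= k < n) (q ^+ k)%:E)).
    by apply: lee_sum => k _; exact: intu.
  rewrite sumEFin lee_fin.
  apply: (@le_trans _ _ (series (geometric 1%R q) n)).
    by rewrite /series/=; apply: ler_sum => k _; rewrite mul1r.
  apply: geometric_le_lim => //; first exact: expR_gt0.
  by rewrite ger0_norm// expR_ge0.
have /(integrable_ae measurableT) : Q.-integrable [set: paths X] S.
  apply/integrableP; split => //.
  by under eq_integral => s _ do rewrite gee0_abs//.
apply: filterS => s /(_ Logic.I) Sfin; exists (fine (S s)) => n.
rewrite JE EFinM fineK//.
have -> : J n s = (expR (g' * n%:R))%:E * u n s.
  by rewrite /u muleA -EFinM -expRD mulNr subrr expR0 mul1e.
rewrite muleC lee_wpmul2r ?lee_fin ?expR_ge0//.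
apply: le_trans (@nneseries_lim_ge _ (u^~ s) xpredT 0 n.+1 _) => //.
by rewrite big_nat_recr//= leeDr// sume_ge0.
Qed.

End parameter.

(** * Likelihood ratios *)

Section ratio_facts.
Context {R : realType} {d : measure_display} {X : measurableType d}.

Lemma ratio_gt0 (p q : X -> R) x : (0 <= p x)%R -> 0 < ratio p q x -> (0 < p x)%R.
Proof.
move=> p0 pq; rewrite lt_neqAle p0 andbT eq_sym; apply: contraTneq pq => px.
by rewrite /ratio px mul0e ltxx.
Qed.

(** The chain rule for ratios fails where [q] vanishes and [p] does not, as
    then [p / q = +oo] is multiplied by [q / r = 0]; finiteness of [p / q]
    excludes exactly this. *)
Lemma ratio_chain (p q r : X -> R) x :
    (0 <= p x)%R -> (0 <= q x)%R -> (0 < r x)%R -> ratio p q x < +oo ->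
  ratio p r x = ratio p q x * ratio q r x.
Proof.
move=> p0 q0 r0; rewrite /ratio !inver (gt_eqF r0) -!EFinM.
have [q00|qn0] := eqVneq (q x) 0%R.
  move: p0; rewrite le_eqVlt => /orP[/eqP <-|p0]; first by rewrite !mul0r !mul0e.
  by rewrite gt0_muley ?ltxx.
by rewrite -!EFinM => _; congr (_%:E); field; rewrite qn0 gt_eqF.
Qed.

(** An inequality rather than an equality because of the points where [p]
    vanishes, at which the product is [0 * +oo = 0]. *)
Lemma ratioM_le1 (p q : X -> R) x : (0 <= p x)%R -> (0 < q x)%R ->
  ratio p q x * ratio q p x <= 1.
Proof.
move=> p0 q0; rewrite /ratio !inver (gt_eqF q0) -!EFinM.
have [->|pn0] := eqVneq (p x) 0%R; first by rewrite !mul0r mul0e.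
by rewrite -!EFinM lee_fin le_eqVlt; apply/orP; left; apply/eqP; field;
  rewrite pn0 gt_eqF.
Qed.

End ratio_facts.

Lemma prode_le1 {R : realType} n (g : nat -> \bar R) :
  (forall i, 0 <= g i) -> (forall i, g i <= 1) -> \prod_(i < n) g i <= 1.
Proof.
move=> g0 g1; elim: n => [|n IH]; first by rewrite big_ord0.
by rewrite big_ord_recr/= -[leRHS]mule1 lee_pmul//; exact: prode_ge0.
Qed.

Lemma cvg0_expR_nat {R : realType} (K k : R) : (0 < k)%R ->
  (K * expR (- k * n%:R))%:E @[n --> \oo] --> 0.
Proof.
move=> k0; apply: cvg_EFin; first exact: nearW.
rewrite (_ : _ \o _ = geometric K (expR (- k))).
  apply: cvg_geometric; rewrite ger0_norm ?expR_ge0//.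
  by rewrite -expR0 ltr_expR oppr_lt0.
by apply/funext => n /=; rewrite expRM_natr.
Qed.

Section likelihood.
Context {R : realType} {d dT : measure_display} {X : measurableType d}
  {T : measurableType dT}.
Variables (nu : probability X R) (Q : probability (paths X) R).
Variable (Pi : probability T R).
Hypothesis QE : iid_law nu Q.
Variable f : T -> X -> R.
Hypothesis f0 : forall t x, (0 <= f t x)%R.
Hypothesis mf : measurable_fun [set: T * X] (fun z => f z.1 z.2).

Lemma measurable_density t : measurable_fun [set: X] (f t).
Proof. exact: (measurable_fun_pair2 t mf). Qed.

Lemma measurable_ratio_pair t1 :
  measurable_fun [set: T * X] (fun z => ratio (f z.1) (f t1) z.2).
Proof.
apply: (@measurable_ratio _ _ (T * X)%type (fun z => f z.1 z.2) (fun z => f t1 z.2)).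
- by [].
- exact: mf.
- exact: measurableT_comp (measurable_density t1) measurable_snd.
Qed.

Lemma measurable_ratio1 t t1 : measurable_fun [set: X] (ratio (f t) (f t1)).
Proof. exact: (measurable_fun_pair2 t (measurable_ratio_pair t1)). Qed.

Lemma ae_lty (h : X -> \bar R) (M : R) : measurable_fun [set: X] h ->
  (forall x, 0 <= h x) -> \int[nu]_x h x <= M%:E -> {ae nu, forall x, h x < +oo}.
Proof.
move=> mh h0 hM.
have /(integrable_ae measurableT) : nu.-integrable [set: X] h.
  apply/integrableP; split => //.
  under eq_integral => x _ do rewrite gee0_abs//.
  by rewrite (le_lt_trans hM)// ltry.
by apply: filterS => x /(_ Logic.I); rewrite ge0_fin_numE.
Qed.

(** Compare with a fixed parameter [t1], factoring each ratio
    [f t / f t0] as [f t / f t1 * (f t1 / f t0)]. The second factors do not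
    depend on [t] and their product is eventually at most [expR (- c0 * n)] by
    [product_growth]; the integrated product of the first factors grows at most
    like [expR (g' * n)], for any [g'] above [g], by [integral_prod_bound]. *)
Lemma local_numerator_decay (t0 t1 : T) (A : set T) (c0 g k : R) :
    measurable A -> (g + k < c0)%R ->
    c0%:E < \int[nu]_x lne (ratio (f t0) (f t1) x) ->
    (forall t, A t -> \int[nu]_x ratio (f t) (f t1) x <= (expR g)%:E) ->
  {ae Q, forall s : paths X,
    (expR (k * n%:R))%:E *
      \int[Pi]_(t in A) (\prod_(i < n) ratio (f t) (f t0) (s i))
      @[n --> \oo] --> 0}.
Proof.
move=> mA gkc c0lt Ag.
have r0 t t' x : 0 <= ratio (f t) (f t') x by exact: ratio_ge0.
(* Any point strictly between [g] and [c0 - k] would do. *)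
pose g' := ((g + (c0 - k)) / 2)%R.
have gg' : (g < g')%R by rewrite /g'; lra.
have g'kc : (g' + k < c0)%R by rewrite /g'; lra.
have mr := measurable_ratio_pair t1.
(* Where [f t1] vanishes and [f t] does not, the ratio is infinite; as its mean
   is finite this happens with probability zero, and Fubini makes the exceptional
   event common to almost all [t] in [A]. *)
have aeA t : {ae Q, forall s : paths X,
    A t -> forall i, ratio (f t) (f t1) (s i) < +oo}.
  have [At|nAt] := pselect (A t); last by apply: aeW => s /nAt.
  have := ae_coord QE (ae_lty (measurable_ratio1 t t1) (r0 t t1) (Ag t At)).
  by apply: filterS => s h _.
have aefin : {ae Q, forall s : paths X, {ae Pi, forall t,
    A t -> forall i, ratio (f t) (f t1) (s i) < +oo}}.
  apply: (@ae_swap _ _ _ _ _ Pi Q [set z : T * paths X |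
    A z.1 -> forall i, ratio (f z.1) (f t1) (z.2 i) < +oo]).
    rewrite (_ : [set z | _] = (~` (A `*` setT)) `|`
      \bigcap_i [set z : T * paths X | ratio (f z.1) (f t1) (z.2 i) < +oo]).
      apply: measurableU; first by apply: measurableC; exact: measurableX.
      apply: bigcap_measurableType => i _.
      rewrite -[X in measurable X]setTI.
      apply: emeasurable_fun_infty_o => //.
      exact: (measurable_coord_pair mr).
    apply/seteqP; split => z /=.
      move=> h; have [Az|nAz] := pselect (A z.1); last by left => -[].
      by right => i _; exact: h.
    by move=> [nAz Az|h _ i]; [exfalso; apply: nAz|exact: h].
  exact: aeA.
have aepos := ae_coord QE (ae_gt0_of_lne (measurable_ratio1 t0 t1) c0lt).
have aegrow := product_growth QE (measurable_ratio1 t0 t1) c0lt.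
have aebound := integral_prod_bound Pi QE mr (fun z => r0 _ _ _) mA gg' Ag.
near=> s.
have sfin : {ae Pi, forall t, A t -> forall i, ratio (f t) (f t1) (s i) < +oo}.
  by near: s.
have spos i : (0 < f t0 (s i))%R.
  apply: (ratio_gt0 (q := f t1)) => //.
  by move: i; near: s.
have sgrow : (expR (- c0 * n%:R))%:E * \prod_(i < n) ratio (f t0) (f t1) (s i)
  @[n --> \oo] --> +oo by near: s.
have [M Mle] : exists M : R, forall n,
  \int[Pi]_(t in A) (\prod_(i < n) ratio (f t) (f t1) (s i)) <=
    (M * expR (g' * n%:R))%:E by near: s.
pose x n := \prod_(i < n) ratio (f t1) (f t0) (s i).
have x0 n : 0 <= x n by exact: prode_ge0.
have x_bound : \forall n \near \oo, x n <= (expR (- c0 * n%:R))%:E.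
  near=> n; have /ltW : 1 < (expR (- c0 * n%:R))%:E *
      \prod_(i < n) ratio (f t0) (f t1) (s i).
    by near: n; exact: cvgey_gt.
  move=> /(lee_wpmul2l (x0 n)); rewrite mule1 => /le_trans; apply.
  rewrite muleCA -[leRHS]mule1; apply: lee_wpmul2l.
    by rewrite lee_fin expR_ge0.
  rewrite /x -big_split/=; apply: (@prode_le1 _ n (fun i =>
    ratio (f t1) (f t0) (s i) * ratio (f t0) (f t1) (s i))) => i.
    exact: mule_ge0.
  exact: ratioM_le1.
have mprod t' n : measurable_fun A
    (fun t => \prod_(i < n) ratio (f t) (f t') (s i)).
  apply: (@measurable_funS _ _ _ _ setT) => //.
  exact: (measurable_fun_pair1 s (measurable_prod_pair (measurable_ratio_pair t') n)).
have num_le n : \int[Pi]_(t in A) (\prod_(i < n) ratio (f t) (f t0) (s i)) <=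
    x n * (M * expR (g' * n%:R))%:E.
  apply: le_trans (lee_wpmul2l (x0 n) (Mle n)).
  rewrite -ge0_integralZl//; last by move=> t _; exact: prode_ge0.
  apply: ae_ge0_le_integral => //.
  - by move=> t _; exact: prode_ge0.
  - by move=> t _; apply: mule_ge0 => //; exact: prode_ge0.
  - exact: measurable_funeM.
  move: sfin; apply: filterS => t h At.
  rewrite /x -big_split/= le_eqVlt; apply/orP; left; apply/eqP.
  by apply: eq_bigr => i _; rewrite muleC; apply: ratio_chain => //; exact: h.
apply: (@squeeze_cvge _ _ _ _ (cst 0) _ (fun n =>
    (M * expR (- (c0 - k - g') * n%:R))%:E)).
- near=> n; rewrite mule_ge0 ?lee_fin ?expR_ge0//=; last first.
    by apply: integral_ge0 => t _; exact: prode_ge0.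
  have M0 : 0 <= (M * expR (g' * n%:R))%:E.
    by apply: le_trans (Mle n); apply: integral_ge0 => t _; exact: prode_ge0.
  apply: (@le_trans _ _ ((expR (k * n%:R))%:E *
      ((expR (- c0 * n%:R))%:E * (M * expR (g' * n%:R))%:E))).
    apply: lee_wpmul2l; first by rewrite lee_fin expR_ge0.
    apply: le_trans (num_le n) _; apply: lee_wpmul2r => //.
    by near: n; exact: x_bound.
  rewrite -!EFinM lee_fin le_eqVlt; apply/orP; left; apply/eqP.
  rewrite (mulrCA _ M) (mulrCA _ M) -!expRD; congr (_ * expR _)%R; ring.
- exact: cvg_cst.
- by apply: cvg0_expR_nat; lra.
Unshelve. all: by end_near. Qed.

End likelihood.

(** * Posterior mass away from the minimiser *)

(** Both sides are differences of the same two nonnegative integrals, whatever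
    their values. *)
Lemma integral_comp_distribution {R : realType} d dW (X : measurableType d)
    (W : measurableType dW) (P : probability W R) (Y : {RV P >-> X})
    (h : X -> \bar R) : measurable_fun [set: X] h ->
  \int[P]_w h (Y w) = \int[distribution P Y]_x h x.
Proof.
move=> mh; rewrite integralE [RHS]integralE.
rewrite (ge0_integral_distribution _ (measurable_funepos mh))//.
rewrite (ge0_integral_distribution _ (measurable_funeneg mh))//.
by congr (_ - _); apply: eq_integral => w _; rewrite /= ?funeposE ?funenegE.
Qed.

Lemma open_mdist_lt {R : realType} (T : metricType R) (x : T) (r : R) :
  open [set y : T | (mdist y x < r)%R].
Proof.
rewrite openE => y /= yr; apply/nbhs_ballP.
exists (r - mdist y x)%R; first by rewrite /= subr_gt0.
rewrite ballEmdist => z /= yz.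
apply: le_lt_trans (metric_triangle z y x) _.
by rewrite metric_sym -ltrBrDr.
Qed.

Lemma open_mdist_gt {R : realType} (T : metricType R) (x : T) (r : R) :
  open [set y : T | (r < mdist y x)%R].
Proof.
rewrite openE => y /= yr; apply/nbhs_ballP.
exists (mdist y x - r)%R; first by rewrite /= subr_gt0.
rewrite ballEmdist => z /= yz.
by have := metric_triangle y z x; lra.
Qed.

Lemma ge0_integral_cover {R : realType} d (T : measurableType d)
    (m : {measure set T -> \bar R}) (I : choiceType) (s : seq I) (A : I -> set T)
    (U : set T) (h : T -> \bar R) :
  measurable U -> (forall i, measurable (A i)) ->
  measurable_fun [set: T] h -> (forall t, 0 <= h t) ->
  (forall t, U t -> exists2 i, i \in s & A i t) ->
  \int[m]_(t in U) h t <= \sum_(i <- s) \int[m]_(t in A i) h t.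
Proof.
move=> mU mA mh h0 UA.
have mi (B : set T) : measurable B -> measurable_fun [set: T] (h \_ B).
  by move=> mB; apply/(measurable_restrictT h mB); exact: measurable_funS mh.
have i0 (B : set T) t : 0 <= (h \_ B) t by rewrite /patch; case: ifP.
rewrite integral_mkcond.
under eq_bigr do rewrite integral_mkcond.
rewrite -ge0_integral_sum//; last by move=> i; exact: mi.
apply: ge0_le_integral => //.
- exact: mi.
- by apply: emeasurable_sum => i; exact: mi.
- move=> t _; rewrite {1}/patch; case: ifPn => [|_]; last first.
    by apply: sume_ge0 => i _.
  rewrite inE => /UA[i si Ait].
  rewrite (perm_big _ (perm_to_rem si))/= big_cons.
  rewrite {1}/patch mem_set// leeDl//.
  by apply: sume_ge0.
Qed.

Lemma inve_le_EFin {R : realType} (D : \bar R) (r : R) :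
  0 <= D -> (0 < r)%R -> 1 <= r%:E * D -> D^-1 <= r%:E.
Proof.
case: D => [D| |//]; rewrite ?lee_fin => D0 r0; last first.
  by move=> _; exact: ltW.
rewrite inver => rD.
have Dn0 : D != 0%R by apply: contraTneq rD => ->; rewrite mulr0 ler10.
rewrite (negbTE Dn0) lee_fin.
have {}D0 : (0 < D)%R by rewrite lt_neqAle eq_sym Dn0.
by rewrite -div1r ler_pdivrMr.
Qed.

Section evidence.
Context {R : realType} {d dT : measure_display} {X : measurableType d}
  {T : measurableType dT}.
Variables (nu : probability X R) (Q : probability (paths X) R).
Variable (Pi : probability T R).
Hypothesis QE : iid_law nu Q.
Variable f : T -> X -> R.
Hypothesis f0 : forall t x, (0 <= f t x)%R.
Hypothesis mf : measurable_fun [set: T * X] (fun z => f z.1 z.2).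

Let L (t0 : T) n (s : paths X) t : \bar R :=
  \prod_(i < n) ratio (f t) (f t0) (s i).

(** A finite cover reduces the decay over [U] to [local_numerator_decay] on each
    piece. *)
Lemma numerator_decay (t0 : T) (U : set T) (A : T -> set T) (D : seq T)
    (c0 g k : R) :
    measurable U -> (forall t, measurable (A t)) ->
    (forall t, U t -> exists2 t1, t1 \in D & A t1 t) ->
    (g + k < c0)%R ->
    (forall t1, t1 \in D -> c0%:E < \int[nu]_x lne (ratio (f t0) (f t1) x)) ->
    (forall t1 t, A t1 t -> \int[nu]_x ratio (f t) (f t1) x <= (expR g)%:E) ->
  {ae Q, forall s : paths X,
    (expR (k * n%:R))%:E * \int[Pi]_(t in U) L t0 n s t @[n --> \oo] --> 0}.
Proof.
move=> mU mA UA gkc Dlt Ag.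
have L0 n s t : 0 <= L t0 n s t by apply: prode_ge0 => i _; exact: ratio_ge0.
have mL n s : measurable_fun [set: T] (L t0 n s).
  exact: (measurable_fun_pair1 s
    (measurable_prod_pair (measurable_ratio_pair f0 mf t0) n)).
have : {ae Q, forall s : paths X, (expR (k * n%:R))%:E *
    \sum_(t1 <- D) \int[Pi]_(t in A t1) L t0 n s t @[n --> \oo] --> 0}.
  move: Dlt {UA}; elim: D => [|t1 D IH] Dlt.
    apply: aeW => s; under eq_fun do rewrite big_nil mule0.
    exact: cvg_cst.
  have := IH (fun t tD => Dlt t (@mem_behead _ (t1 :: D) t tD)).
  have := local_numerator_decay Pi QE f0 mf (mA t1) gkc (Dlt t1 (mem_head _ _))
    (Ag t1).
  apply: filterS2 => s h1 h2.
  under eq_fun => n.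
    rewrite big_cons ge0_muleDr; last 2 first.
      by apply: integral_ge0.
      by apply: sume_ge0 => t _; exact: integral_ge0.
    over.
  have h := cvgeD (isT : (0 : \bar R) +? 0) h1 h2; rewrite adde0 in h.
  exact: h.
apply: filterS => s h.
apply: (@squeeze_cvge _ _ _ _ (cst 0) _ _ _ _ (cvg_cst _) h).
apply: nearW => n; apply/andP; split.
  apply: mule_ge0; first by rewrite lee_fin expR_ge0.
  exact: integral_ge0.
apply: lee_wpmul2l; first by rewrite lee_fin expR_ge0.
exact: ge0_integral_cover.
Qed.

(** The evidence is at least its part over [V], where the drift of the log-ratio
    is above [- k]. *)
Lemma denominator_growth (t0 : T) (V : set T) (k : R) :
    measurable V -> 0 < Pi V ->
    (forall t, V t -> (- k)%:E < \int[nu]_x lne (ratio (f t) (f t0) x)) ->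
  {ae Q, forall s : paths X,
    (expR (k * n%:R))%:E * \int[Pi]_t L t0 n s t @[n --> \oo] --> +oo}.
Proof.
move=> mV V0 Vlt.
have L0 n s t : 0 <= L t0 n s t by apply: prode_ge0 => i _; exact: ratio_ge0.
have mL n s : measurable_fun [set: T] (L t0 n s).
  exact: (measurable_fun_pair1 s
    (measurable_prod_pair (measurable_ratio_pair f0 mf t0) n)).
have := integral_prod_growth QE (measurable_ratio_pair f0 mf t0)
  (fun z => ratio_ge0 (f0 _) (f0 _) _) mV V0 Vlt.
apply: filterS => s; apply: gee_cvgy; apply: nearW => n.
rewrite opprK; apply: lee_wpmul2l; first by rewrite lee_fin expR_ge0.
by apply: ge0_subset_integral => //; [exact: mL|move=> t _; exact: L0].
Qed.

End evidence.

Local Close Scope ereal_scope.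

Theorem theorem2p1 (R : realType)
  (dX : measure_display) (X : measurableType dX)
  (mu : {measure set X -> \bar R})
  (p0 : X -> R) (p0_density : is_density mu p0)
  (dW : measure_display) (W : measurableType dW) (P : probability W R)
  (Y : nat -> {RV P >-> X}) (Y_iid : iid_with_density mu Y p0)
  (Theta : pmetricType R)
  (f : Theta -> X -> R)
  (f_density : forall theta, is_density mu (f theta))
  (f_measurable : measurable_fun [set: borel Theta * X]
     (fun z : borel Theta * X => f z.1 z.2))
  (Pi : probability (borel Theta) R)
  (thetastar : Theta)
  (thetastar_argmin : forall theta,
     (mean_log_ratio (Y 0%N) p0 (f thetastar) <=
      mean_log_ratio (Y 0%N) p0 (f theta))%E)
  (thetastar_support : in_support Pi thetastar)
  (mean_log_continuous : continuous (fun theta : Theta =>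
     mean_log_ratio (Y 0%N) (f theta) (f thetastar)))
  (mean_ratio_continuous : forall theta1 : Theta,
     continuous (fun theta : Theta =>
       mean_ratio (Y 0%N) (f theta) (f theta1)))
  (neighborhood_condition : forall eta : R, 0 < eta ->
     exists2 delta : R, 0 < delta < 1 &
       [set theta : Theta |
         (mean_log_ratio (Y 0%N) (f thetastar) (f theta) < delta%:E)%E]
       `<=` [set theta : Theta | mdist theta thetastar < eta])
  (Theta_compact : compact [set: Theta])
  (epsilon : R) (epsilon_gt0 : 0 < epsilon) :
  {ae P, forall w : W,
    (fun n : nat => posterior Y Pi f thetastar n w
       [set theta : Theta | mdist theta thetastar > epsilon])
    @ \oo --> 0%E}.
Proof.
Local Open Scope ereal_scope.
set U := [set theta : Theta | _].
have f0 t x : (0 <= f t x)%R by case: (f_density t).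
have mopen (A : set Theta) : open A -> measurable (A : set (borel Theta)).
  exact: sub_sigma_algebra.
have mU : measurable (U : set (borel Theta)) by apply: mopen; exact: open_mdist_gt.
(* If no parameter is far from [thetastar] there is nothing to prove; otherwise
   such a parameter shows below that [f thetastar] is almost surely positive. *)
have [U0|/set0P[theta0 theta0U]] := eqVneq U set0.
  apply: aeW => w; under eq_fun do
    rewrite /posterior U0 integral_set0 mul0e.
  exact: cvg_cst.
set nu := distribution P (Y 0%N).
set Q := distribution P (sample_path Y).
have QE : iid_law nu Q by exact: iid_law_sample_path Y_iid.
have mr t t1 : measurable_fun [set: X] (ratio (f t) (f t1)).
  exact: (measurable_ratio1 (T := borel Theta) f0 f_measurable).
have mean_logE t t1 : mean_log_ratio (Y 0%N) (f t) (f t1) =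
    \int[nu]_x lne (ratio (f t) (f t1) x).
  rewrite /mean_log_ratio.
  by rewrite -(integral_comp_distribution (Y 0%N) (measurable_lne (mr t t1))).
have mean_ratioE t t1 : mean_ratio (Y 0%N) (f t) (f t1) =
    \int[nu]_x ratio (f t) (f t1) x.
  by rewrite /mean_ratio -(integral_comp_distribution (Y 0%N) (mr t t1)).
(* The neighbourhood condition, contraposed: parameters at distance at least
   [epsilon] have divergence at least [delta], uniformly. *)
have [delta /andP[delta0 _] deltaU] := neighborhood_condition _ epsilon_gt0.
have far t : (epsilon <= mdist t thetastar)%R ->
    delta%:E <= \int[nu]_x lne (ratio (f thetastar) (f t) x).
  rewrite -mean_logE !leNgt; apply: contraNN => h.
  exact: deltaU.
(* The budget: decay rate [delta / 2] for the reference parameters, minus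
   [delta / 8] lost in the comparison within a piece, still leaves room for the
   normalisation [expR (e8 * n)] that makes the evidence blow up. *)
pose e8 := (delta / 8)%R.
have e80 : (0 < e8)%R by rewrite /e8; lra.
have far_lt t : (epsilon <= mdist t thetastar)%R ->
    (delta / 2)%:E < \int[nu]_x lne (ratio (f thetastar) (f t) x).
  by move=> /far; apply: lt_le_trans; rewrite lte_fin; lra.
(* Where [f thetastar] vanishes [lne (0 / 0) = -oo], so positivity almost
   everywhere matters here. *)
have log0 : \int[nu]_x lne (ratio (f thetastar) (f thetastar) x) = 0.
  have := ae_gt0_of_lne (mr _ _) (far_lt _ (ltW theta0U)) => pos.
  rewrite (@ae_eq_integral _ _ _ nu setT (cst 0))//.
  - by rewrite integral_cst// mul0e.
  - exact: measurable_lne.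
  - move: pos; apply: filterS => x /(ratio_gt0 (f0 _ _)) fx _ /=.
    by rewrite /ratio inver gt_eqF// -EFinM divff ?gt_eqF// lne1.
pose V := [set theta : Theta | (- e8)%:E <
  mean_log_ratio (Y 0%N) (f theta) (f thetastar)].
have oV : open V.
  exact: ((continuousP _).1 mean_log_continuous _ (@open_ereal_gt_ereal R (- e8)%:E)).
have V0 : 0 < Pi V.
  have Vstar : V thetastar by rewrite /V /= mean_logE log0 lte_fin oppr_lt0.
  have /nbhs_ballP[r /= r0 rV] := open_nbhs_nbhs (conj oV Vstar).
  apply: lt_le_trans (thetastar_support r r0) _.
  apply: le_measure; rewrite ?inE; [|exact: mopen|].
    by apply: mopen; exact: open_mdist_lt.
  by move=> t tr; apply: rV; rewrite ballEmdist /= metric_sym.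
have denom : {ae Q, forall s : paths X, (expR (e8 * n%:R))%:E *
    \int[Pi]_t (\prod_(i < n) ratio (f t) (f thetastar) (s i))
    @[n --> \oo] --> +oo}.
  apply: (denominator_growth (T := borel Theta) QE f0 f_measurable (mopen _ oV) V0).
  by move=> t; rewrite /V /= mean_logE.
pose K := [set t : Theta | (epsilon <= mdist t thetastar)%R].
have cK : compact K.
  apply: subclosed_compact Theta_compact _ => //.
  rewrite -openC (_ : ~` K = [set t : Theta | (mdist t thetastar < epsilon)%R]).
    exact: open_mdist_lt.
  by apply/seteqP; split => t /=; rewrite ltNge => /negP.
pose A (t1 : Theta) := [set t : Theta |
  mean_ratio (Y 0%N) (f t) (f t1) < (expR e8)%:E].
have oA t1 : open (A t1).
  exact: ((continuousP _).1 (mean_ratio_continuous t1) _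
    (@open_ereal_lt_ereal R (expR e8)%:E)).
(* [f t1 / f t1] is 0 or 1, so its mean is at most 1 and [t1] belongs to its own
   piece. *)
have AA t1 : A t1 t1.
  rewrite /A /= mean_ratioE.
  apply: (@le_lt_trans _ _ 1); last by rewrite lte_fin -expR0 ltr_expR.
  rewrite -(integral_probability_cst nu 1); apply: ge0_le_integral => //.
  - by move=> x _; exact: ratio_ge0.
  - move=> x _; rewrite /ratio inver; case: ifPn => [/eqP ->|fx].
      by rewrite mul0e.
    by rewrite -EFinM divff.
have [D DK KD] : finite_subset_cover K A K.
  move: cK; rewrite compact_cover; apply => // t Kt.
  by exists t.
have numer : {ae Q, forall s : paths X, (expR (e8 * n%:R))%:E *
    \int[Pi]_(t in U) (\prod_(i < n) ratio (f t) (f thetastar) (s i))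
    @[n --> \oo] --> 0}.
  apply: (@numerator_decay _ _ _ _ (borel Theta) nu Q Pi QE f f0 f_measurable
    thetastar U A (enum_fset D) (delta / 2)%R e8 e8 mU).
  - by move=> t; apply: mopen.
  - by move=> t tU; have [t1 /= t1D At1] := KD t (ltW tU); exists t1.
  - by rewrite /e8; lra.
  - by move=> t1 t1D; apply: far_lt; have := DK _ t1D; rewrite inE.
  - by move=> t1 t /ltW; rewrite mean_ratioE.
have := ae_sample_path numer; have := ae_sample_path denom.
apply: filterS2 => w Dw Nw.
apply: (@squeeze_cvge _ _ _ _ (cst 0) _ _ _ _ (cvg_cst _) Nw).
(* Eventually the normalised evidence is at least 1, and then the posterior mass
   is at most the normalised numerator. *)
near=> n.
have D0 : 0 <= \int[Pi]_t likelihood_ratio Y f thetastar n w t.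
  by apply: integral_ge0 => t _; apply: prode_ge0 => i _; exact: ratio_ge0.
have N0 : 0 <= \int[Pi]_(t in U) likelihood_ratio Y f thetastar n w t.
  by apply: integral_ge0 => t _; apply: prode_ge0 => i _; exact: ratio_ge0.
rewrite /posterior mule_ge0 ?inve_ge0//= muleC.
apply: lee_wpmul2r => //.
apply: inve_le_EFin => //; first exact: expR_gt0.
by near: n; exact: cvgey_ge.
Unshelve. all: by end_near. Qed.
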